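(* Let $k$ be a field with $\operatorname{char} k\neq 2$, let $L$ be a Lie algebra over $k$ with $\dim L\le 3$, and let $r\in L\otimes L$. If $r$ is strongly symmetric, then $r$ is a solution of the CYBE in $L$.
   Context: For a Lie algebra $L$ over $k$ and $r=\sum_i a_i\otimes b_i\in L\otimes L$, define in $L\otimes L\otimes L$: $[r^{12},r^{13}]=\sum_{i,j}[a_i,a_j]\otimes b_i\otimes b_j$, $[r^{12},r^{23}]=\sum_{i,j}a_i\otimes[b_i,a_j]\otimes b_j$, $[r^{13},r^{23}]=\sum_{i,j}a_i\otimes a_j\otimes[b_i,b_j]$. The element $r$ is a solution of the classical Yang–Baxter equation (CYBE) in $L$ if $[r^{12},r^{13}]+[r^{12},r^{23}]+[r^{13},r^{23}]=0$. Let $\{e_1,\dots,e_n\}$ be a basis of $L$ and $r=\sum_{i,j}k_{ij}(e_i\otimes e_j)$ with $k_{ij}\in k$. Then $r$ is strongly symmetric if $k_{ij}=k_{ji}$ and $k_{ij}k_{lm}=k_{il}k_{jm}$ for all $i,j,l,m\in\{1,\dots,n\}$; this is independent of the choice of basis. *)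

(* Defs.v *)
From HB Require Import structures.
From mathcomp Require Import all_boot all_order all_algebra.

Set Implicit Arguments.
Unset Strict Implicit.
Unset Printing Implicit Defensive.

Import GRing.Theory.
Local Open Scope ring_scope.

(* The bracket is alternating, [x, x] = 0, and not merely antisymmetric. *)
HB.mixin Record hasLieBracket (k : fieldType) L of GRing.Lmodule k L := {
  lie : L -> L -> L;
  lie_is_linearl : forall y, linear (lie^~ y);
  lie_is_linearr : forall x, linear (lie x);
  liexx : forall x, lie x x = 0;
  lie_jacobi : forall x y z,
    lie x (lie y z) + lie y (lie z x) + lie z (lie x y) = 0
}.

#[short(type="finLieAlgType")]
HB.structure Definition FinLieAlgebra (k : fieldType) :=
  { L of hasLieBracket k L & Vector k L }.

Notation "⟦ x , y ⟧" := (lie x y)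
  (at level 0, x, y at level 99, format "⟦ x ,  y ⟧") : ring_scope.

Section Tensor.

Variable k : fieldType.
Implicit Types U V W : vectType k.

Definition dual U : vectType k := 'Hom(U, k^o).

(* For finite-dimensional spaces U ⊗ V is canonically isomorphic to
   Hom(U^*, V), u ⊗ v corresponding to phi |-> phi(u) v. *)
Definition tensor U V : vectType k := 'Hom(dual U, V).

Definition pure_tensor_fun U V (u : U) (v : V) (phi : dual U) : V :=
  (phi u : k) *: v.

Lemma pure_tensor_fun_is_linear U V (u : U) (v : V) :
  linear (pure_tensor_fun u v).
Proof.
by move=> a p q; rewrite /pure_tensor_fun add_lfunE scale_lfunE scalerDl scalerA.
Qed.

HB.instance Definition _ U V (u : U) (v : V) :=
  GRing.isLinear.Build k (dual U) V _ (pure_tensor_fun u v)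
    (pure_tensor_fun_is_linear u v).

Definition pure_tensor U V (u : U) (v : V) : tensor U V :=
  linfun (pure_tensor_fun u v).

Local Notation "u ⊗ v" := (pure_tensor u v) (at level 40, left associativity).

Lemma pure_tensorE U V (u : U) (v : V) (phi : dual U) :
  (u ⊗ v : 'Hom(_, _)) phi = (phi u : k) *: v.
Proof. by rewrite lfunE. Qed.

Lemma pure_tensor_linearl U V (v : V) : linear (fun u : U => u ⊗ v).
Proof.
move=> a x y; apply/lfunP => phi; rewrite add_lfunE scale_lfunE !pure_tensorE.
by rewrite linearP scalerDl scalerA.
Qed.

Lemma pure_tensor_linearr U V (u : U) : linear (fun v : V => u ⊗ v).
Proof.
move=> a x y; apply/lfunP => phi; rewrite add_lfunE scale_lfunE !pure_tensorE.
by rewrite scalerDr !scalerA mulrC.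
Qed.

Definition dual_basis U n (e : n.-tuple U) (i : 'I_n) : dual U :=
  linfun (coord e i : U -> k^o).

Lemma dual_basisE U n (e : n.-tuple U) i u : dual_basis e i u = coord e i u.
Proof. by rewrite lfunE. Qed.

Lemma dual_expand U n (e : n.-tuple U) (phi : dual U) : basis_of fullv e ->
  phi = \sum_(i < n) (phi e`_i : k) *: dual_basis e i.
Proof.
move=> eb; apply/lfunP => u; rewrite sum_lfunE.
rewrite {1}(coord_basis eb (memvf u)) linear_sum; apply: eq_bigr => i _.
by rewrite linearZ scale_lfunE dual_basisE; apply: mulrC.
Qed.

Lemma tensor_expand U V n (e : n.-tuple U) (t : tensor U V) :
  basis_of fullv e ->
  t = \sum_(i < n) e`_i ⊗ (t : 'Hom(_, _)) (dual_basis e i).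
Proof.
move=> eb; apply/lfunP => phi; rewrite sum_lfunE.
rewrite {1}(dual_expand phi eb) linear_sum; apply: eq_bigr => i _.
by rewrite linearZ pure_tensorE.
Qed.

(* The linear map on U ⊗ V sending u ⊗ v to f u v, for f bilinear. The choice
   of basis is immaterial by tlift_pure and tlift_linear below. *)
Definition tlift U V W (f : U -> V -> W) (t : tensor U V) : W :=
  \sum_(i < \dim {:U}) f (vbasis {:U})`_i ((t : 'Hom(_, _)) (dual_basis (vbasis {:U}) i)).

Lemma tlift_linear U V W (f : U -> V -> W) :
  (forall u, linear (f u)) -> linear (tlift f).
Proof.
move=> fr a s t; rewrite /tlift scaler_sumr -big_split; apply: eq_bigr => i _.
by rewrite add_lfunE scale_lfunE fr.
Qed.

Lemma tlift_pure U V W (f : U -> V -> W) :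
  (forall v, linear (f^~ v)) -> (forall u, linear (f u)) ->
  forall u v, tlift f (u ⊗ v) = f u v.
Proof.
move=> fl fr u v.
pose gM := GRing.isLinear.Build k U W _ (f^~ v) (fl v).
pose g : {linear U -> W} := HB.pack (f^~ v) gM.
rewrite /tlift -[RHS]/(g u) {2}(coord_basis (vbasisP _) (memvf u)) linear_sum.
apply: eq_bigr => i _; rewrite pure_tensorE dual_basisE linearZ /=.
pose hM := GRing.isLinear.Build k V W _ (f (vbasis {:U})`_i) (fr _).
pose h : {linear V -> W} := HB.pack (f (vbasis {:U})`_i) hM.
exact: (linearZ_LR h).
Qed.

Lemma tlift_sum U V W (f : U -> V -> W) n (a : 'I_n -> U) (b : 'I_n -> V) :
  (forall v, linear (f^~ v)) -> (forall u, linear (f u)) ->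
  tlift f (\sum_i a i ⊗ b i) = \sum_i f (a i) (b i).
Proof.
move=> fl fr.
pose gM := GRing.isLinear.Build k (tensor U V) W _ (tlift f) (tlift_linear fr).
pose g : {linear tensor U V -> W} := HB.pack (tlift f) gM.
rewrite -[LHS]/(g _) linear_sum; apply: eq_bigr => i _; exact: tlift_pure.
Qed.

End Tensor.

Notation "u ⊗ v" := (pure_tensor u v) (at level 40, left associativity)
  : ring_scope.

Section YangBaxter.

Variables (k : fieldType) (L : finLieAlgType k).
Implicit Type r : tensor L L.

Definition r12r13 r : tensor (tensor L L) L :=
  tlift (fun a b => tlift (fun a' b' => ⟦a, a'⟧ ⊗ b ⊗ b') r) r.

Definition r12r23 r : tensor (tensor L L) L :=
  tlift (fun a b => tlift (fun a' b' => a ⊗ ⟦b, a'⟧ ⊗ b') r) r.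

Definition r13r23 r : tensor (tensor L L) L :=
  tlift (fun a b => tlift (fun a' b' => a ⊗ a' ⊗ ⟦b, b'⟧) r) r.

Definition CYBE_solution r : Prop := r12r13 r + r12r23 r + r13r23 r = 0.

Lemma tlift2_sum (W : vectType k) (F : L -> L -> L -> L -> W) n
    (a b : 'I_n -> L) :
  (forall b a' b', linear (fun a => F a b a' b')) ->
  (forall a a' b', linear (fun b => F a b a' b')) ->
  (forall a b b', linear (fun a' => F a b a' b')) ->
  (forall a b a', linear (F a b a')) ->
  let r := \sum_i a i ⊗ b i in
  tlift (fun a b => tlift (F a b) r) r =
  \sum_i \sum_j F (a i) (b i) (a j) (b j).
Proof.
move=> F1 F2 F3 F4 r; have E x y : tlift (F x y) r = \sum_j F x y (a j) (b j).
  exact: tlift_sum.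
rewrite tlift_sum; first by apply: eq_bigr => i _; rewrite E.
- move=> v c x y; rewrite !E scaler_sumr -big_split.
  by apply: eq_bigr => i _; rewrite F1.
- move=> u c x y; rewrite !E scaler_sumr -big_split.
  by apply: eq_bigr => i _; rewrite F2.
Qed.

Lemma r12r13_sum n (a b : 'I_n -> L) :
  r12r13 (\sum_i a i ⊗ b i) = \sum_i \sum_j ⟦a i, a j⟧ ⊗ b i ⊗ b j.
Proof.
apply: (tlift2_sum (F := fun a b a' b' => ⟦a, a'⟧ ⊗ b ⊗ b')) => *;
  move=> c x y; by rewrite ?lie_is_linearl ?lie_is_linearr
    ?pure_tensor_linearr ?pure_tensor_linearl ?pure_tensor_linearl.
Qed.

Lemma r12r23_sum n (a b : 'I_n -> L) :
  r12r23 (\sum_i a i ⊗ b i) = \sum_i \sum_j a i ⊗ ⟦b i, a j⟧ ⊗ b j.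
Proof.
apply: (tlift2_sum (F := fun a b a' b' => a ⊗ ⟦b, a'⟧ ⊗ b')) => *;
  move=> c x y; by rewrite ?lie_is_linearl ?lie_is_linearr
    ?pure_tensor_linearr ?pure_tensor_linearl ?pure_tensor_linearl.
Qed.

Lemma r13r23_sum n (a b : 'I_n -> L) :
  r13r23 (\sum_i a i ⊗ b i) = \sum_i \sum_j a i ⊗ a j ⊗ ⟦b i, b j⟧.
Proof.
apply: (tlift2_sum (F := fun a b a' b' => a ⊗ a' ⊗ ⟦b, b'⟧)) => *;
  move=> c x y; by rewrite ?lie_is_linearl ?lie_is_linearr
    ?pure_tensor_linearr ?pure_tensor_linearl ?pure_tensor_linearl.
Qed.

Definition strongly_symmetric_mx n (K : 'M[k]_n) : Prop :=
  (forall i j, K i j = K j i) /\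
  (forall i j l m, K i j * K l m = K i l * K j m).

Definition tensor_mx n (e : n.-tuple L) (K : 'M[k]_n) : tensor L L :=
  \sum_(i < n) \sum_(j < n) K i j *: (e`_i ⊗ e`_j).

(* Independent of the choice of basis, see strongly_symmetricP. *)
Definition strongly_symmetric r : Prop :=
  exists (n : nat) (e : n.-tuple L) (K : 'M[k]_n),
    [/\ basis_of {:L} e, r = tensor_mx e K & strongly_symmetric_mx K].

Lemma tensor_mx_exists n (e : n.-tuple L) r :
  basis_of {:L} e -> exists K, r = tensor_mx e K.
Proof.
move=> eb.
exists (\matrix_(i, j) coord e j ((r : 'Hom(_, _)) (dual_basis e i))).
rewrite {1}(tensor_expand r eb); apply: eq_bigr => i _.
rewrite {1}(coord_basis eb (memvf ((r : 'Hom(_, _)) (dual_basis e i)))).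
pose gM := GRing.isLinear.Build k L (tensor L L) _ (pure_tensor e`_i)
  (pure_tensor_linearr e`_i).
pose g : {linear L -> tensor L L} := HB.pack (pure_tensor (e`_i : L)) gM.
rewrite -[LHS]/(g _) linear_sum; apply: eq_bigr => j _.
by rewrite linearZ mxE.
Qed.

Lemma tensor_mx_coord n (e : n.-tuple L) (K : 'M[k]_n) p (e' : p.-tuple L) i j :
  coord e' j ((tensor_mx e K : 'Hom(_, _)) (dual_basis e' i)) =
  \sum_(a < n) \sum_(b < n) coord e' i e`_a * coord e' j e`_b * K a b.
Proof.
rewrite /tensor_mx sum_lfunE linear_sum; apply: eq_bigr => a _.
rewrite sum_lfunE linear_sum; apply: eq_bigr => b _.
by rewrite scale_lfunE linearZ pure_tensorE dual_basisE linearZ /= mulrC.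
Qed.

Lemma strongly_symmetricP n (e : n.-tuple L) (K : 'M[k]_n) :
  basis_of {:L} e ->
  strongly_symmetric (tensor_mx e K) <-> strongly_symmetric_mx K.
Proof.
move=> eb; split=> [[p [e' [K' [e'b rE [sym str]]]]] | Ks]; last first.
  by exists n, e, K.
have ef : free e by apply: basis_free eb.
have KE i j : K i j = \sum_(a < p) \sum_(b < p) coord e i e'`_a * coord e j e'`_b * K' a b.
  rewrite -tensor_mx_coord -rE tensor_mx_coord.
  rewrite (bigD1 i) //= (bigD1 j) //= !big1 ?addr0.
  - by rewrite !coord_free // !eqxx !mul1r.
  - move=> a ai; rewrite big1 // => b _.
    by rewrite coord_free // (negbTE ai) !mul0r.
  - move=> b bj; by rewrite (coord_free _ j) // (negbTE bj) mulr0 mul0r.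
have KKE i j l m : K i j * K l m =
    \sum_(a < p) \sum_(b < p) \sum_(c < p) \sum_(d < p)
    coord e i e'`_a * coord e j e'`_b * coord e l e'`_c * coord e m e'`_d *
    (K' a b * K' c d).
  rewrite !KE mulr_suml; apply: eq_bigr => a _.
  rewrite mulr_suml; apply: eq_bigr => b _.
  rewrite mulr_sumr; apply: eq_bigr => c _.
  rewrite mulr_sumr; apply: eq_bigr => d _.
  by rewrite mulrACA !mulrA.
split=> [i j | i j l m].
  rewrite !KE exchange_big; apply: eq_bigr => a _; apply: eq_bigr => b _.
  by rewrite sym [coord e i _ * _]mulrC.
rewrite !KKE; apply: eq_bigr => a _; rewrite exchange_big.
apply: eq_bigr => b _; apply: eq_bigr => c _; apply: eq_bigr => d _.
by rewrite str -!mulrA; congr (_ * _); rewrite mulrCA.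
Qed.

End YangBaxter.

(* Main.v *)
Require Import Defs.
From mathcomp Require Import all_boot all_order all_algebra.

(** Strong symmetry of r says that its coefficient matrix K is symmetric with
    vanishing 2 x 2 minors, that is, K = a v v^T for a scalar a and a column v
    ([strongly_symmetric_mx_rank1]).  Hence r = (a w) ⊗ w for a single
    vector w of L ([strongly_symmetric_tensor_rank1]).  For such an r each of
    the three terms of the Yang-Baxter expression is one pure tensor having a
    multiple of [w, w] = 0 as a factor, so each vanishes separately
    ([rank1_CYBE]). *)

Set Implicit Arguments.
Unset Strict Implicit.
Unset Printing Implicit Defensive.

Import GRing.Theory.
Local Open Scope ring_scope.

(** With l = i the condition reads K i j * K i m = K i i * K j m.  A nonzero
    diagonal entry K i i thus expresses K through its row i; if the diagonal is
    zero, then taking m = j gives K i j ^ 2 = 0 for all i and j, so K = 0. *)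
Lemma strongly_symmetric_mx_rank1 (k : fieldType) n (K : 'M[k]_n) :
  strongly_symmetric_mx K ->
  exists (a : k) (v : 'I_n -> k), forall i j, K i j = a * v i * v j.
Proof.
move=> [_ str]; have [/existsP[i Kii]|] := boolP [exists i, K i i != 0].
  exists (K i i)^-1, (K i) => j m.
  by rewrite -mulrA (str i j i m) mulKf.
rewrite negb_exists => /forallP Kd; exists 0, (fun=> 0) => i j.
apply/eqP; rewrite !mul0r -[_ == 0]orbb -mulf_eq0 str.
by move: (Kd i); rewrite negbK => /eqP ->; rewrite mul0r.
Qed.

Lemma strongly_symmetric_tensor_rank1 (k : fieldType) (L : finLieAlgType k)
    (r : tensor L L) :
  strongly_symmetric r -> exists (a : k) (w : L), r = (a *: w) ⊗ w.
Proof.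
move=> [n [e [K [_ -> /strongly_symmetric_mx_rank1[a [v KE]]]]]].
exists a, (\sum_(i < n) v i *: e`_i); apply/lfunP => phi.
have phiE : phi (a *: \sum_(i < n) v i *: e`_i) =
    \sum_(i < n) a * v i * (phi e`_i : k) :> k.
  rewrite scaler_sumr linear_sum; apply: eq_bigr => i _.
  by rewrite scalerA linearZ.
rewrite pure_tensorE phiE scaler_suml sum_lfunE; apply: eq_bigr => i _.
rewrite scaler_sumr sum_lfunE; apply: eq_bigr => j _.
by rewrite scale_lfunE pure_tensorE !scalerA KE mulrAC.
Qed.

Lemma rank1_CYBE (k : fieldType) (L : finLieAlgType k) (a : k) (w : L) :
  CYBE_solution ((a *: w) ⊗ w).
Proof.
have lieZ : ⟦w, a *: w⟧ = 0.
  by rewrite (scalable_linear (lie_is_linearr w)) /= liexx scaler0.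
have tensor0l (U V : vectType k) (v : V) : (0 : U) ⊗ v = 0.
  by apply/lfunP => phi; rewrite pure_tensorE linear0 scale0r lfunE.
have tensor0r (U V : vectType k) (u : U) : u ⊗ (0 : V) = 0.
  by apply/lfunP => phi; rewrite pure_tensorE scaler0 lfunE.
(* A one-term sum, so that the formulas for sums of pure tensors apply. *)
have -> : (a *: w) ⊗ w = \sum_(i < 1) (a *: w) ⊗ w by rewrite big_ord1.
rewrite /CYBE_solution (r12r13_sum (fun=> a *: w) (fun=> w)).
rewrite (r12r23_sum (fun=> a *: w) (fun=> w)).
rewrite (r13r23_sum (fun=> a *: w) (fun=> w)) !big_ord1.
by rewrite !liexx lieZ !(tensor0l, tensor0r) !addr0.
Qed.

Theorem corollary1p7 (k : fieldType) (L : finLieAlgType k) (r : tensor L L)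
    (char_neq2 : 2%N \notin [pchar k]) (dim_le3 : (\dim {:L} <= 3)%N) :
  strongly_symmetric r -> CYBE_solution r.
Proof.
by move=> /strongly_symmetric_tensor_rank1[a [w ->]]; apply: rank1_CYBE.
Qed.
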